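(* Let $a\ge2$ be real and $\widetilde{\mathcal Z}=\widetilde R_{a,1}\cup\widetilde R_{1,a}$. Then for all $\alpha\in[0,1]$, $$2(a-1)\big((1-\alpha)-2(1-\alpha)^2\big)\le\widetilde I(\alpha,\alpha,\widetilde{\mathcal Z})\le2(a-1)(1-\alpha).$$
   Context: $\widetilde R_{a,b}=[0,a]\times[0,b]$. A Euclidean zero-set is a closed $\widetilde{\mathcal Z}\subseteq[0,\infty)^2$ such that $(a,b)\in\widetilde{\mathcal Z}$ implies $\widetilde R_{a,b}\subseteq\widetilde{\mathcal Z}$, and $\widetilde{\mathcal Z}$ is the closure of $\widetilde{\mathcal Z}\cap(0,\infty)^2$. For Borel $A\subseteq[0,\infty)^2$, $\widetilde{\mathrm{row}}(x,A)$ (resp. $\widetilde{\mathrm{col}}(x,A)$) is the 1-dimensional Lebesgue measure of $A$ intersected with the horizontal (resp. vertical) line through $x$. For left-continuous nonincreasing $f,g:[0,\infty)\to[0,\infty)$ of compact support, $\widetilde{\mathcal T}(A)=A\cup\{(u,v):(\widetilde{\mathrm{row}}((u,v),A)+f(v),\widetilde{\mathrm{col}}((u,v),A)+g(u))\notin\widetilde{\mathcal Z}\}$; $A$ E-spans for $(\widetilde{\mathcal Z},f,g)$ if $\bigcup_n\widetilde{\mathcal T}^n(A)=[0,\infty)^2$. For bounded $\widetilde{\mathcal Z}$ and $(\alpha,\beta)\in[0,1]^2$: $\widetilde I(\alpha,\beta,\widetilde{\mathcal Z})=\inf\{\mathrm{area}(A)+(1-\alpha)\int_0^\infty f+(1-\beta)\int_0^\infty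 g\}$ over all $(A,f,g)$ with $A$ compact E-spanning for $(\widetilde{\mathcal Z},f,g)$. *)

(* Defs.v *)
From Stdlib Require Import Reals Lra ClassicalEpsilon.
Open Scope R_scope.

(** Extended reals (needed: Lebesgue measures may be infinite, infima may be +oo). *)
Inductive ereal := EFin (x : R) | EPInf | ENInf.

Definition ele (x y : ereal) : Prop :=
  match x, y with
  | ENInf, _ => True
  | _, EPInf => True
  | EFin a, EFin b => a <= b
  | _, _ => False
  end.

Definition eadd (x y : ereal) : ereal :=
  match x, y with
  | EFin a, EFin b => EFin (a + b)
  | EPInf, ENInf | ENInf, EPInf => EFin 0 (* never used *)
  | EPInf, _ | _, EPInf => EPInf
  | _, _ => ENInf
  end.

Definition is_glb (E : R -> Prop) (m : R) : Prop :=
  (forall x, E x -> m <= x) /\ (forall m', (forall x, E x -> m' <= x) -> m' <= m).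

Definition einf (E : R -> Prop) : ereal :=
  match excluded_middle_informative (exists x, E x) with
  | right _ => EPInf
  | left _ =>
      match excluded_middle_informative (exists m, forall x, E x -> m <= x) with
      | left _ => EFin (epsilon (inhabits 0) (is_glb E))
      | right _ => ENInf
      end
  end.

Definition len_cover_val (S : R -> Prop) (t : R) : Prop :=
  exists c d : nat -> R,
    (forall n, c n <= d n) /\
    (forall x, S x -> exists n, c n < x < d n) /\
    infinite_sum (fun n => d n - c n) t.

Definition leb1 (S : R -> Prop) : ereal := einf (len_cover_val S).

Definition area_cover_val (S : R * R -> Prop) (t : R) : Prop :=
  exists a b c d : nat -> R,
    (forall n, a n <= b n /\ c n <= d n) /\
    (forall p, S p -> exists n, a n < fst p < b n /\ c n < snd p < d n) /\
    infinite_sum (fun n => (b n - a n) * (d n - c n)) t.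

Definition area (S : R * R -> Prop) : ereal := einf (area_cover_val S).

Definition quadrant (p : R * R) : Prop := 0 <= fst p /\ 0 <= snd p.

Definition trow (p : R * R) (A : R * R -> Prop) : ereal :=
  leb1 (fun s => A (s, snd p)).
Definition tcol (p : R * R) (A : R * R -> Prop) : ereal :=
  leb1 (fun s => A (fst p, s)).

Definition zin (Z : R * R -> Prop) (x y : ereal) : Prop :=
  match x, y with
  | EFin a, EFin b => Z (a, b)
  | _, _ => False
  end.

Definition Ttil (Z : R * R -> Prop) (f g : R -> R) (A : R * R -> Prop) (p : R * R) : Prop :=
  A p \/
  (quadrant p /\
   ~ zin Z (eadd (trow p A) (EFin (f (snd p)))) (eadd (tcol p A) (EFin (g (fst p))))).

Fixpoint Titer (Z : R * R -> Prop) (f g : R -> R) (n : nat) (A : R * R -> Prop)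
  : R * R -> Prop :=
  match n with
  | O => A
  | S k => Ttil Z f g (Titer Z f g k A)
  end.

Definition espans (Z : R * R -> Prop) (f g : R -> R) (A : R * R -> Prop) : Prop :=
  forall p, (exists n, Titer Z f g n A p) <-> quadrant p.

(** compact subset of R^2 (closed and bounded, Heine-Borel) *)
Definition compact2 (A : R * R -> Prop) : Prop :=
  (exists M, forall p, A p -> Rabs (fst p) <= M /\ Rabs (snd p) <= M) /\
  (forall p, (forall eps, 0 < eps -> exists q, A q /\
                Rabs (fst q - fst p) < eps /\ Rabs (snd q - snd p) < eps) -> A p).

Definition admissible (f : R -> R) : Prop :=
  (forall x, 0 <= x -> 0 <= f x) /\
  (forall x y, 0 <= x -> x <= y -> f y <= f x) /\
  (forall x, 0 < x -> forall eps, 0 < eps ->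
     exists del, 0 < del /\ forall y, 0 <= y -> x - del < y <= x -> Rabs (f y - f x) < eps) /\
  (exists M, forall x, M <= x -> f x = 0).

Definition integral0inf (f : R -> R) (I : R) : Prop :=
  exists M, 0 <= M /\ (forall x, M <= x -> f x = 0) /\
    exists pr : Riemann_integrable f 0 M, RiemannInt pr = I.

Definition Itil (alpha beta : R) (Z : R * R -> Prop) : ereal :=
  einf (fun v => exists (A : R * R -> Prop) (f g : R -> R) (ar If Ig : R),
    compact2 A /\ admissible f /\ admissible g /\
    espans Z f g A /\
    area A = EFin ar /\ integral0inf f If /\ integral0inf g Ig /\
    v = ar + (1 - alpha) * If + (1 - beta) * Ig).

Definition Rtil (a b : R) (p : R * R) : Prop :=
  0 <= fst p <= a /\ 0 <= snd p <= b.

Definition Zab (a : R) (p : R * R) : Prop := Rtil a 1 p \/ Rtil 1 a p.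

(* Main.v *)
(** Cover [A] by finitely many rectangles and add to [f], [g] the horizontal, vertical
    sections of this cover, obtaining functions [F], [G] with
    [int F + int G <= int f + int g + 2 area(A)] up to an arbitrarily small error.  If
    [s + |{G > r}|] and [r + |{F > s}|] form a point of the zero-set, then the cover together
    with the columns [{G > r}] and the rows [{F > s}] is stable, so [A] does not span.
    Taking [r = 1 - y] and [s = a - |{G > r}|], spanning forces [|{F > s}| > y] for every
    [y] in [[0,1]]; integrating over [y] gives [int (F - 1)^+ + int min(G, 1) >= a - 1].
    Adding the same inequality with [F] and [G] exchanged,
    [int f + int g + 2 area(A) >= 2 (a - 1)], and the lower bound follows.  For the upper
    bound take [A] empty and [f = g] slightly above [a - 1] on an interval slightly longer
    than [[0,1]]. *)

From Stdlib Require Import Reals Lra Lia Arith List Classical ClassicalEpsilon.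
From Coquelicot Require Import Coquelicot.
Require Import Defs.
Open Scope R_scope.

(** * Finite sums over lists and indicators of propositions *)

Fixpoint lsum {T : Type} (w : T -> R) (l : list T) : R :=
  match l with
  | nil => 0
  | x :: l' => w x + lsum w l'
  end.

Definition ind (P : Prop) : R := if excluded_middle_informative P then 1 else 0.

Lemma ind_cases (P : Prop) : (P /\ ind P = 1) \/ (~ P /\ ind P = 0).
Proof.
  unfold ind; destruct (excluded_middle_informative P); auto.
Qed.

Lemma ind_bounds (P : Prop) : 0 <= ind P <= 1.
Proof.
  destruct (ind_cases P) as [[_ ->]|[_ ->]]; lra.
Qed.

Lemma ind_impl (P Q : Prop) : (P -> Q) -> ind P <= ind Q.
Proof.
  intros H; destruct (ind_cases P) as [[? ->]|[? ->]];
    destruct (ind_cases Q) as [[? ->]|[? ->]]; tauto || lra.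
Qed.

Lemma lsum_le {T : Type} (v w : T -> R) (l : list T) :
  (forall x, In x l -> v x <= w x) -> lsum v l <= lsum w l.
Proof.
  induction l as [|x l IH]; simpl; intros H; [lra|].
  assert (v x <= w x) by auto. assert (lsum v l <= lsum w l) by auto. lra.
Qed.

Lemma lsum_nonneg {T : Type} (w : T -> R) (l : list T) :
  (forall x, In x l -> 0 <= w x) -> 0 <= lsum w l.
Proof.
  induction l as [|x l IH]; simpl; intros H; [lra|].
  assert (0 <= w x) by auto. assert (0 <= lsum w l) by auto. lra.
Qed.

Lemma lsum_plus {T : Type} (v w : T -> R) (l : list T) :
  lsum (fun x => v x + w x) l = lsum v l + lsum w l.
Proof. induction l; simpl; lra. Qed.

Lemma lsum_scal {T : Type} (c : R) (w : T -> R) (l : list T) :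
  lsum (fun x => c * w x) l = c * lsum w l.
Proof. induction l; simpl; lra. Qed.

Lemma lsum_const {T : Type} (c : R) (l : list T) :
  lsum (fun _ => c) l = c * INR (length l).
Proof.
  induction l as [|x l IH]; [simpl; lra|].
  cbn [lsum length]. rewrite S_INR, IH. lra.
Qed.

Lemma lsum_ext {T : Type} (v w : T -> R) (l : list T) :
  (forall x, In x l -> v x = w x) -> lsum v l = lsum w l.
Proof.
  intros H; apply Rle_antisym; apply lsum_le; intros x Hx;
    rewrite (H x Hx); lra.
Qed.

Lemma lsum_app {T : Type} (w : T -> R) (l l' : list T) :
  lsum w (l ++ l') = lsum w l + lsum w l'.
Proof. induction l; simpl; lra. Qed.

Lemma lsum_map {S T : Type} (w : T -> R) (u : S -> T) (l : list S) :
  lsum w (map u l) = lsum (fun x => w (u x)) l.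
Proof. induction l; simpl; lra. Qed.

Lemma lsum_filter {T : Type} (w : T -> R) (P : T -> Prop) (p : T -> bool) (l : list T) :
  (forall x, p x = true <-> P x) ->
  lsum w (filter p l) = lsum (fun x => ind (P x) * w x) l.
Proof.
  intros Hp; induction l as [|x l IH]; simpl; [reflexivity|].
  destruct (ind_cases (P x)) as [[HP ->]|[HP ->]]; destruct (p x) eqn:E; simpl; rewrite ?IH.
  - lra.
  - apply Hp in HP; congruence.
  - apply Hp in E; tauto.
  - lra.
Qed.

Lemma lsum_exchange {S T : Type} (w : S -> T -> R) (l : list S) (l' : list T) :
  lsum (fun x => lsum (w x) l') l = lsum (fun y => lsum (fun x => w x y) l) l'.
Proof.
  induction l as [|x l IH]; simpl.
  - induction l'; simpl; lra.
  - rewrite lsum_plus, IH. reflexivity.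
Qed.

Lemma lsum_seq_S (w : nat -> R) (n : nat) :
  lsum w (seq 0 (S n)) = lsum w (seq 0 n) + w n.
Proof. rewrite seq_S, lsum_app; simpl; lra. Qed.

Lemma lsum_seq_shift (w : nat -> R) (n : nat) :
  lsum (fun i => w (S i)) (seq 0 n) = lsum w (seq 0 n) - w 0%nat + w n.
Proof.
  induction n as [|n IH]; [simpl; lra|].
  rewrite !lsum_seq_S, IH. lra.
Qed.

(** * Layer-cake sums and the tradeoff between superlevel functions *)

Lemma Abel_sum (t : nat -> R) (n : nat) :
  lsum (fun i => (t i - t (S i)) * INR i) (seq 0 n)
  = lsum (fun i => t (S i)) (seq 0 n) - INR n * t n.
Proof.
  induction n as [|n IH]; [simpl; lra|].
  rewrite !lsum_seq_S, IH, S_INR. ring.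
Qed.

(** Riemann sum for the integral of the indicator of [x > 1 - y] over [0 <= y <= 1]. The levels are
    [1], [1 - 1 / n], ..., [1 / n], without [0], so the bound carries no error term. *)
Lemma layers_below_1 (n : nat) (x : R) : (0 < n)%nat -> 0 <= x ->
  lsum (fun i => ind (x > 1 - INR i / INR n)) (seq 0 n) <= INR n * Rmin x 1.
Proof.
  intros Hn Hx.
  assert (Hn' : 0 < INR n) by (apply lt_0_INR; lia).
  (* The levels decrease with [i]: once one of them lies below [x], so do all later ones, and from
     then on the count and the bound both grow by one. *)
  assert (Hm : forall m, lsum (fun i => ind (x > 1 - INR i / INR n)) (seq 0 m)
             <= Rmax 0 (INR n * Rmin x 1 - INR n + INR m)).
  { induction m as [|m IH]; [apply Rmax_l|].
    rewrite lsum_seq_S, S_INR.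
    destruct (ind_cases (x > 1 - INR m / INR n)) as [[H ->]|[H ->]].
    - assert (INR n * (1 - INR m / INR n) = INR n - INR m) by (field; lra).
      assert (INR n * (1 - INR m / INR n) < INR n * x) by (apply Rmult_lt_compat_l; lra).
      assert (0 <= INR m) by apply pos_INR.
      assert (0 <= INR n * Rmin x 1 - INR n + INR m).
      { unfold Rmin; destruct (Rle_dec x 1); lra. }
      rewrite Rmax_right in IH by lra. rewrite Rmax_right; lra.
    - eapply Rle_trans; [rewrite Rplus_0_r; exact IH|].
      apply Rle_max_compat_l; lra. }
  specialize (Hm n). rewrite Rmax_right in Hm; [lra|].
  assert (0 <= INR n * Rmin x 1); [|lra].
  apply Rmult_le_pos; [lra|]. apply Rmin_glb; lra.
Qed.

(** Since [t] decreases, [x] exceeds precisely a final segment of the levels, and the drops over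
    that segment telescope to a level below [x] minus [t n]. *)
Lemma layers_above (t : nat -> R) (n : nat) (x : R) :
  (forall i, t (S i) <= t i) ->
  lsum (fun i => (t i - t (S i)) * ind (x > t i)) (seq 0 n) <= Rmax 0 (x - t n).
Proof.
  intros Ht; induction n as [|n IH]; [apply Rmax_l|].
  rewrite lsum_seq_S.
  destruct (ind_cases (x > t n)) as [[H ->]|[H ->]]; specialize (Ht n).
  - rewrite Rmax_right in IH by lra. rewrite Rmax_right; lra.
  - rewrite Rmax_left in IH by lra.
    assert (0 <= Rmax 0 (x - t (S n))) by apply Rmax_l. lra.
Qed.

(** The length of the set where a step function exceeds [s]; each entry of [l] stands for one step
    of width [h]. *)
Definition superlevel {T : Type} (h : R) (l : list T) (G : T -> R) (s : R) : R :=
  h * lsum (fun k => ind (G k > s)) l.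

Lemma superlevel_nonneg {T : Type} (h : R) (l : list T) (G : T -> R) (s : R) :
  0 <= h -> 0 <= superlevel h l G s.
Proof.
  intros Hh; apply Rmult_le_pos; [exact Hh|].
  apply lsum_nonneg; intros; apply ind_bounds.
Qed.

Lemma superlevel_anti {T : Type} (h : R) (l : list T) (G : T -> R) (s s' : R) :
  0 <= h -> s <= s' -> superlevel h l G s' <= superlevel h l G s.
Proof.
  intros Hh Hs; apply Rmult_le_compat_l; [exact Hh|].
  apply lsum_le; intros; apply ind_impl; lra.
Qed.

(* Writing [phi], [gamma] for the superlevel functions of [F], [G] and [F*] for the
   decreasing rearrangement of [F], the hypothesis says [F* y >= a - gamma (1 - y)];
   integrate this over [0 <= y <= 1], here by Riemann sums of step [1 / n]. *)
Lemma superlevel_tradeoff_approx {T : Type} (h a : R) (l : list T) (F G : T -> R) (n : nat) :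
  0 < h -> 1 <= a -> (0 < n)%nat -> (forall k, 0 <= G k) ->
  (forall y, 0 <= y <= 1 -> superlevel h l G (1 - y) <= a ->
     y <= superlevel h l F (a - superlevel h l G (1 - y))) ->
  (a - 1) * (1 - / INR n)
  <= h * lsum (fun k => Rmax 0 (F k - 1)) l + h * lsum (fun k => Rmin (G k) 1) l.
Proof.
  intros Hh Ha Hn HG Hy.
  assert (Hn' : 0 < INR n) by (apply lt_0_INR; lia).
  assert (Hin : 0 < / INR n) by (apply Rinv_0_lt_compat; lra).
  set (gam := fun i : nat => superlevel h l G (1 - INR i / INR n)).
  (* The levels [a - gam i], cut off below at [1] and ending at exactly [1], so that the layers of
     [F] above them add up to at most [Rmax 0 (F k - 1)]. *)
  set (t := fun i => if lt_dec i n then Rmax 1 (a - gam i) else 1).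
  assert (Hgam0 : forall i, 0 <= gam i) by (intros; apply superlevel_nonneg; lra).
  assert (Hgam : forall i, gam i <= gam (S i)).
  { intros i; apply superlevel_anti; [lra|]. rewrite S_INR.
    unfold Rdiv. assert (INR i * / INR n <= (INR i + 1) * / INR n); [|lra].
    apply Rmult_le_compat_r; lra. }
  assert (Ht : forall i, t (S i) <= t i).
  { intros i; unfold t. specialize (Hgam i).
    destruct (lt_dec (S i) n); destruct (lt_dec i n); try lia.
    - apply Rle_max_compat_l; lra.
    - apply Rmax_l.
    - lra. }
  assert (Htn : t n = 1) by (unfold t; destruct (lt_dec n n); [lia|reflexivity]).
  assert (H1 : / INR n * lsum gam (seq 0 n) <= h * lsum (fun k => Rmin (G k) 1) l).
  { apply Rle_trans with (/ INR n * (h * lsum (fun k => INR n * Rmin (G k) 1) l)).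
    - apply Rmult_le_compat_l; [lra|].
      unfold gam, superlevel. rewrite lsum_scal.
      apply Rmult_le_compat_l; [lra|]. rewrite lsum_exchange.
      apply lsum_le; intros; apply layers_below_1; auto.
    - rewrite lsum_scal. right; field; lra. }
  assert (H2 : / INR n * lsum (fun i => (t i - t (S i)) * INR i) (seq 0 n)
               <= h * lsum (fun k => Rmax 0 (F k - 1)) l).
  { apply Rle_trans with
      (lsum (fun i => (t i - t (S i)) * superlevel h l F (t i)) (seq 0 n)).
    - rewrite <- lsum_scal. apply lsum_le; intros i Hi.
      apply in_seq in Hi. specialize (Ht i).
      replace (/ INR n * ((t i - t (S i)) * INR i))
        with ((t i - t (S i)) * (INR i / INR n)) by (unfold Rdiv; ring).
      assert (Hi1 : 0 <= INR i / INR n <= 1).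
      { split; [apply Rmult_le_pos; [apply pos_INR|lra]|].
        apply Rmult_le_reg_r with (INR n); [lra|].
        replace (INR i / INR n * INR n) with (INR i) by (field; lra).
        rewrite Rmult_1_l. apply le_INR; lia. }
      assert (Ht1 : 1 <= t (S i)).
      { unfold t; destruct (lt_dec (S i) n); [apply Rmax_l|lra]. }
      (* If [t i] is [1], the drop is zero. Otherwise the cut-off is inactive, [gam i < a], and the
         hypothesis at [y = i / n] applies. *)
      destruct (Rle_lt_dec (t i) 1) as [Hle|Hlt].
      + replace (t i - t (S i)) with 0 by lra. lra.
      + apply Rmult_le_compat_l; [lra|].
        assert (E : t i = a - gam i).
        { revert Hlt; unfold t; destruct (lt_dec i n); [|lra].
          unfold Rmax; destruct (Rle_dec 1 (a - gam i)); lra. }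
        rewrite E. apply Hy; [exact Hi1|]. fold (gam i). lra.
    - unfold superlevel.
      apply Rle_trans with
        (h * lsum (fun k => lsum (fun i => (t i - t (S i)) * ind (F k > t i)) (seq 0 n)) l).
      + rewrite lsum_exchange, <- lsum_scal. right. apply lsum_ext; intros i _.
        rewrite lsum_scal. ring.
      + apply Rmult_le_compat_l; [lra|]. apply lsum_le; intros k _.
        rewrite <- Htn. apply layers_above, Ht. }
  (* Summation by parts leaves the sum of the [t i], minus [t 0], plus [1], minus [n]. As
     [t 0 <= a], the shift of index costs at most [(a - 1) / n] after division by [n]. *)
  rewrite Abel_sum, lsum_seq_shift, Htn in H2.
  assert (H3 : a * INR n - lsum gam (seq 0 n) <= lsum t (seq 0 n)).
  { replace (a * INR n - lsum gam (seq 0 n)) with (lsum (fun i => a + -1 * gam i) (seq 0 n)).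
    - apply lsum_le; intros i Hi; apply in_seq in Hi; unfold t.
      destruct (lt_dec i n); [|lia].
      eapply Rle_trans; [|apply Rmax_r]. lra.
    - rewrite lsum_plus, lsum_const, lsum_scal, length_seq. ring. }
  assert (H4 : t 0%nat <= a).
  { unfold t; destruct (lt_dec 0 n); [|lra]. apply Rmax_lub; [lra|].
    specialize (Hgam0 0%nat); lra. }
  apply Rle_trans with (/ INR n * ((a * INR n - lsum gam (seq 0 n)) - a + 1 - INR n * 1)
                        + / INR n * lsum gam (seq 0 n)).
  - right; field; lra.
  - apply Rplus_le_compat; [|exact H1].
    eapply Rle_trans; [|exact H2]. apply Rmult_le_compat_l; lra.
Qed.

Lemma superlevel_tradeoff {T : Type} (h a : R) (l : list T) (F G : T -> R) :
  0 < h -> 1 <= a -> (forall k, 0 <= G k) ->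
  (forall y, 0 <= y <= 1 -> superlevel h l G (1 - y) <= a ->
     y <= superlevel h l F (a - superlevel h l G (1 - y))) ->
  a - 1 <= h * lsum (fun k => Rmax 0 (F k - 1)) l + h * lsum (fun k => Rmin (G k) 1) l.
Proof.
  intros Hh Ha HG Hy. apply le_epsilon; intros eps Heps.
  destruct (archimed_cor1 (eps / a)) as [n [Hn Hn0]].
  { apply Rdiv_lt_0_compat; lra. }
  assert (H := superlevel_tradeoff_approx h a l F G n Hh Ha Hn0 HG Hy).
  assert (a * / INR n <= eps).
  { replace eps with (a * (eps / a)) by (field; lra). apply Rmult_le_compat_l; lra. }
  assert (0 < / INR n) by (apply Rinv_0_lt_compat, lt_0_INR; lia).
  lra.
Qed.

(** * Infima and one-dimensional Lebesgue measure *)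

Lemma glb_exists (E : R -> Prop) :
  (exists x, E x) -> (exists m, forall x, E x -> m <= x) -> exists m, is_glb E m.
Proof.
  intros [x0 Hx0] [m Hm].
  destruct (completeness (fun z => E (- z))) as [s [Hs1 Hs2]].
  - exists (- m); intros z Hz; apply Hm in Hz; lra.
  - exists (- x0); rewrite Ropp_involutive; exact Hx0.
  - exists (- s); split.
    + intros x Hx. assert (- x <= s); [|lra].
      apply Hs1. rewrite Ropp_involutive; exact Hx.
    + intros m' Hm'. assert (s <= - m'); [|lra].
      apply Hs2; intros z Hz; apply Hm' in Hz; lra.
Qed.

Lemma einf_finite (E : R -> Prop) (x m : R) :
  E x -> (forall z, E z -> m <= z) -> exists r, einf E = EFin r /\ is_glb E r.
Proof.
  intros Hx Hm; unfold einf.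
  destruct (excluded_middle_informative _) as [H1|H1]; [|exfalso; eauto].
  destruct (excluded_middle_informative _) as [H2|H2]; [|exfalso; eauto].
  eexists; split; [reflexivity|]. apply epsilon_spec, glb_exists; assumption.
Qed.

Lemma einf_EFin (E : R -> Prop) (r : R) : einf E = EFin r -> is_glb E r.
Proof.
  unfold einf.
  destruct (excluded_middle_informative _) as [H1|H1]; [|discriminate].
  destruct (excluded_middle_informative _) as [H2|H2]; [|discriminate].
  intros [= <-]. apply epsilon_spec, glb_exists; assumption.
Qed.

Lemma glb_approx (E : R -> Prop) (r eps : R) :
  is_glb E r -> 0 < eps -> exists x, E x /\ x < r + eps.
Proof.
  intros [_ H2] Heps. apply NNPP; intros Hn.
  assert (r + eps <= r); [|lra].
  apply H2; intros x Hx. apply Rnot_lt_le; intros Hlt. apply Hn; eauto.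
Qed.

Lemma infinite_sum_ge_0 (u : nat -> R) (t : R) :
  (forall n, 0 <= u n) -> infinite_sum u t -> 0 <= t.
Proof.
  intros Hu Ht. apply Rle_trans with (sum_f_R0 u 0); [apply Hu|].
  apply sum_incr; assumption.
Qed.

Lemma infinite_sum_ge_lsum (u : nat -> R) (t : R) (n : nat) :
  (forall n, 0 <= u n) -> infinite_sum u t -> lsum u (seq 0 n) <= t.
Proof.
  intros Hu Ht. apply Rle_trans with (sum_f_R0 u n).
  - assert (E : forall m, sum_f_R0 u m = lsum u (seq 0 (S m))).
    { induction m as [|m IH]; [simpl; lra|]. rewrite lsum_seq_S, <- IH. reflexivity. }
    rewrite E, lsum_seq_S. specialize (Hu n); lra.
  - apply sum_incr; assumption.
Qed.

Lemma infinite_sum_cons (u : nat -> R) (x t : R) :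
  infinite_sum u t -> infinite_sum (fun n => match n with O => x | S k => u k end) (x + t).
Proof.
  intros Hu. apply is_series_Reals. apply is_series_decr_1.
  apply is_series_Reals.
  match goal with |- infinite_sum _ ?v => replace v with t end; [exact Hu|].
  unfold plus, opp; simpl; ring.
Qed.

(** The summand has the form [0 - 0] because it is the length of the degenerate intervals that pad a
    finite cover to a sequence. *)
Lemma infinite_sum_0 : infinite_sum (fun _ => 0 - 0) 0.
Proof.
  intros eps Heps. exists 0%nat; intros n _.
  replace (sum_f_R0 (fun _ => 0 - 0) n) with 0.
  - unfold Rdist. rewrite Rminus_diag, Rabs_R0. exact Heps.
  - induction n as [|n IH]; simpl; rewrite <- ?IH; lra.
Qed.

Lemma len_cover_val_ge_0 (S : R -> Prop) (t : R) : len_cover_val S t -> 0 <= t.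
Proof.
  intros [c [d [Hcd [_ Hs]]]].
  apply infinite_sum_ge_0 in Hs; [exact Hs|]. intros n; specialize (Hcd n); lra.
Qed.

(** Covers consist of open intervals, so each closed interval is enlarged by [eps] at both ends. *)
Lemma len_cover_val_intervals {T : Type} (I : T -> R * R) (l : list T) (eps : R)
    (S : R -> Prop) :
  0 < eps -> (forall k, In k l -> fst (I k) <= snd (I k)) ->
  (forall x, S x -> exists k, In k l /\ fst (I k) <= x <= snd (I k)) ->
  len_cover_val S (lsum (fun k => snd (I k) - fst (I k) + 2 * eps) l).
Proof.
  intros Heps; revert S; induction l as [|k l IH]; intros S HI HS.
  - exists (fun _ => 0), (fun _ => 0). split; [intros; lra|split].
    + intros x Hx; apply HS in Hx; destruct Hx as [k [[] _]].
    + apply infinite_sum_0.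
  - destruct (IH (fun x => exists k, In k l /\ fst (I k) <= x <= snd (I k)))
      as [c [d [Hcd [Hcov Hsum]]]]; [intros; apply HI; right; assumption|auto|].
    exists (fun n => match n with O => fst (I k) - eps | S m => c m end),
      (fun n => match n with O => snd (I k) + eps | S m => d m end).
    split; [|split].
    + intros [|n]; [|apply Hcd]. assert (fst (I k) <= snd (I k)) by (apply HI; left; auto). lra.
    + intros x Hx. apply HS in Hx. destruct Hx as [k' [[->|Hin] Hk']].
      * exists 0%nat; lra.
      * destruct (Hcov x) as [n Hn]; [eauto|]. exists (Datatypes.S n); exact Hn.
    + simpl. apply infinite_sum_cons with (x := snd (I k) - fst (I k) + 2 * eps) in Hsum.
      apply is_series_Reals in Hsum. apply is_series_Reals.
      eapply is_series_ext; [|exact Hsum]. intros [|n]; simpl; [ring|reflexivity].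
Qed.

Lemma leb1_intervals {T : Type} (I : T -> R * R) (l : list T) (S : R -> Prop) :
  (forall k, In k l -> fst (I k) <= snd (I k)) ->
  (forall x, S x -> exists k, In k l /\ fst (I k) <= x <= snd (I k)) ->
  exists m, leb1 S = EFin m /\ 0 <= m <= lsum (fun k => snd (I k) - fst (I k)) l.
Proof.
  intros HI HS.
  destruct (einf_finite (len_cover_val S) _ 0
    (len_cover_val_intervals I l 1 S Rlt_0_1 HI HS) (len_cover_val_ge_0 S)) as [m [Hm [Hl Hg]]].
  exists m; split; [exact Hm|]. split; [apply Hg, len_cover_val_ge_0|].
  set (N := INR (length l)). assert (HN : 0 <= N) by apply pos_INR.
  apply le_epsilon; intros eps Heps.
  (* With this enlargement the [N] intervals grow by at most [eps] in total; [N + 1] keeps the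
     denominator positive for an empty list. *)
  assert (He : 0 < eps / (2 * (N + 1))) by (apply Rdiv_lt_0_compat; lra).
  assert (H := Hl _ (len_cover_val_intervals I l _ S He HI HS)).
  rewrite lsum_plus, lsum_const in H. fold N in H.
  assert (2 * (eps / (2 * (N + 1))) * N <= eps); [|lra].
  replace (2 * (eps / (2 * (N + 1))) * N) with (eps * (N / (N + 1))) by (field; lra).
  rewrite <- (Rmult_1_r eps) at 2. apply Rmult_le_compat_l; [lra|].
  apply Rmult_le_reg_r with (N + 1); [lra|].
  replace (N / (N + 1) * (N + 1)) with N by (field; lra). lra.
Qed.

(* Continuous induction on [x]: [x] is at most the total length of the first [N]
   intervals truncated at [x]. *)
Lemma len_cover_val_ge_interval (S : R -> Prop) (M t : R) :
  0 <= M -> (forall x, 0 <= x <= M -> S x) -> len_cover_val S t -> M <= t.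
Proof.
  intros HM HS [c [d [Hcd [Hcov Hsum]]]].
  (* [tr x n] is the length of the part of the [n]-th interval to the left of [x]. *)
  set (tr := fun (x : R) (n : nat) => Rmax 0 (Rmin x (d n) - c n)).
  set (P := fun x => 0 <= x <= M /\ exists N, x <= lsum (tr x) (seq 0 N)).
  assert (Hmono : forall x y n, x <= y -> tr x n <= tr y n).
  { intros x y n Hxy. apply Rle_max_compat_l. apply Rplus_le_compat_r.
    apply Rle_min_compat_r, Hxy. }
  assert (Hstep : forall x y n, c n <= x -> x <= y -> y <= d n -> tr y n = tr x n + (y - x)).
  { intros x y n H1 H2 H3; unfold tr.
    rewrite (Rmin_left y), (Rmin_left x) by lra. rewrite !Rmax_right by lra. lra. }
  assert (Hsumle : forall x y N, x <= y -> lsum (tr x) (seq 0 N) <= lsum (tr y) (seq 0 N)).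
  { intros x y N Hxy; apply lsum_le; intros; apply Hmono, Hxy. }
  assert (Htr0 : forall x n, 0 <= tr x n) by (intros; apply Rmax_l).
  (* Moving from [x] to [y] inside the [n]-th interval adds [y - x] to its truncated length and
     decreases no other; the number of intervals is enlarged to include index [n]. *)
  assert (Hext : forall x y n, P x -> c n <= x -> x <= y -> y <= d n -> y <= M -> P y).
  { intros x y n [Hx [N HN]] H1 H2 H3 H4. split; [lra|].
    assert (Hgen : forall N, (n < N)%nat ->
        lsum (tr x) (seq 0 N) + (y - x) <= lsum (tr y) (seq 0 N)).
    { induction N0 as [|N0 IH]; [lia|]. intros HnN. rewrite !lsum_seq_S.
      destruct (Nat.eq_dec n N0) as [->|Hne].
      - rewrite (Hstep x y N0 H1 H2 H3). specialize (Hsumle x y N0 H2). lra.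
      - specialize (Hmono x y N0 H2). assert (n < N0)%nat by lia.
        specialize (IH H). lra. }
    assert (Hinc : forall k, lsum (tr x) (seq 0 N) <= lsum (tr x) (seq 0 (N + k))).
    { induction k as [|k IH]; [rewrite Nat.add_0_r; lra|].
      rewrite Nat.add_succ_r, lsum_seq_S. specialize (Htr0 x (N + k)%nat). lra. }
    exists (N + Datatypes.S n)%nat.
    specialize (Hgen (N + Datatypes.S n)%nat ltac:(lia)).
    specialize (Hinc (Datatypes.S n)). lra. }
  assert (P0 : P 0).
  { split; [lra|]. exists 0%nat; simpl; lra. }
  destruct (completeness P) as [s [Hs1 Hs2]].
  { exists M; intros x [Hx _]; lra. }
  { exists 0; exact P0. }
  assert (Hs0 : 0 <= s) by (apply Hs1, P0).
  assert (HsM : s <= M) by (apply Hs2; intros x [Hx _]; lra).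
  destruct (Hcov s (HS s (conj Hs0 HsM))) as [n Hn].
  assert (Hx : exists x, P x /\ c n < x <= s).
  { apply NNPP; intros Hno. assert (s <= c n); [|lra].
    apply Hs2; intros x Hx. apply Rnot_lt_le; intros Hlt. apply Hno.
    exists x; split; [exact Hx|split; [exact Hlt|apply Hs1, Hx]]. }
  destruct Hx as [x [Px Hx]].
  (* The interval around the supremum [s] contains a point of [P] at or to the left of [s], hence
     carries [P] up to [M] or to its right end [d n]; the latter exceeds [s], which is
     impossible. *)
  assert (PM : P M).
  { destruct (Rle_lt_dec M (d n)).
    - apply (Hext x M n); auto; lra.
    - exfalso. assert (d n <= s); [|lra]. apply Hs1.
      apply (Hext x (d n) n); auto; lra. }
  destruct PM as [_ [N HN]].
  apply Rle_trans with (1 := HN).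
  apply Rle_trans with (lsum (fun n => d n - c n) (seq 0 N)).
  - apply lsum_le; intros k _; unfold tr. specialize (Hcd k).
    apply Rmax_lub; [lra|]. assert (Rmin M (d k) <= d k) by apply Rmin_r. lra.
  - apply infinite_sum_ge_lsum; [|exact Hsum]. intros k; specialize (Hcd k); lra.
Qed.

Lemma leb1_ge_interval (S : R -> Prop) (M m : R) :
  0 <= M -> (forall x, 0 <= x <= M -> S x) -> leb1 S = EFin m -> M <= m.
Proof.
  intros HM HS Hm. apply einf_EFin in Hm. apply Hm.
  intros t Ht; eapply len_cover_val_ge_interval; eauto.
Qed.

Lemma leb1_ge_0 (S : R -> Prop) (m : R) : leb1 S = EFin m -> 0 <= m.
Proof.
  intros Hm; apply einf_EFin in Hm. apply Hm, len_cover_val_ge_0.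
Qed.

(** * Area, and finite covers of compact sets by rectangles *)

Lemma area_cover_val_ge_0 (S : R * R -> Prop) (t : R) : area_cover_val S t -> 0 <= t.
Proof.
  intros [a [b [c [d [Habcd [_ Hs]]]]]].
  apply infinite_sum_ge_0 in Hs; [exact Hs|]. intros n; specialize (Habcd n).
  apply Rmult_le_pos; lra.
Qed.

Lemma area_ge_0 (S : R * R -> Prop) (r : R) : area S = EFin r -> 0 <= r.
Proof.
  intros Hm; apply einf_EFin in Hm. apply Hm, area_cover_val_ge_0.
Qed.

Lemma area_empty : area (fun _ => False) = EFin 0.
Proof.
  assert (H0 : area_cover_val (fun _ => False) 0).
  { exists (fun _ => 0), (fun _ => 0), (fun _ => 0), (fun _ => 0).
    split; [intros; lra|split; [intros p []|]].
    apply is_series_Reals. eapply is_series_ext; [|apply is_series_Reals, infinite_sum_0].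
    intros n; simpl; ring. }
  destruct (einf_finite _ _ 0 H0 (area_cover_val_ge_0 _)) as [r [Hr [H1 H2]]].
  unfold area; rewrite Hr; f_equal. apply Rle_antisym; [apply H1, H0|].
  apply H2, area_cover_val_ge_0.
Qed.

(** Each point of the plane gets a radius: at a point of [A] the neighbourhood stays in one covering
    rectangle, and elsewhere it misses [A] because [A] is closed. Finitely many such neighbourhoods
    cover a box containing [A]. *)
Lemma compact2_finite_subcover (A : R * R -> Prop) (a b c d : nat -> R) :
  compact2 A ->
  (forall p, A p -> exists n, a n < fst p < b n /\ c n < snd p < d n) ->
  exists N, forall p, A p ->
    exists n, (n < N)%nat /\ a n < fst p < b n /\ c n < snd p < d n.
Proof.
  intros [[M HM] Hcl] Hcov.
  assert (Hloc : forall t : Compactness.Tn 2 R, exists e : posreal, exists n,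
    let '(x, (y, _)) := t in
    forall p, A p -> Rabs (fst p - x) < e -> Rabs (snd p - y) < e ->
      a n < fst p < b n /\ c n < snd p < d n).
  { intros [x [y []]]. destruct (classic (A (x, y))) as [HA|HA].
    - destruct (Hcov _ HA) as [n [H1 H2]]; simpl in H1, H2.
      assert (He : 0 < Rmin (Rmin (x - a n) (b n - x)) (Rmin (y - c n) (d n - y))).
      { repeat apply Rmin_pos; lra. }
      exists (mkposreal _ He), n; simpl. intros p Hp Hx Hy.
      apply Rmin_Rgt_l in Hx as [Hx _], Hy as [_ Hy].
      apply Rmin_Rgt_l in Hx as [Hx1 Hx2], Hy as [Hy1 Hy2].
      apply Rabs_def2 in Hx1, Hx2, Hy1, Hy2. lra.
    - assert (Hne : exists e, 0 < e /\ forall q, A q -> Rabs (fst q - x) < e ->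
                    Rabs (snd q - y) < e -> False).
      { apply NNPP; intros Hno. apply HA, Hcl. intros e He. apply NNPP; intros Hno2.
        apply Hno. exists e; split; [exact He|]. intros q Hq H1 H2. apply Hno2; eauto. }
      (* The index [0] is a dummy: no point of [A] lies in this neighbourhood. *)
      destruct Hne as [e [He Hq]]. exists (mkposreal e He), 0%nat; simpl.
      intros p Hp H1 H2; exfalso; eauto. }
  apply choice in Hloc as [del Hdel]. apply choice in Hdel as [idx Hidx].
  (* [compactness_list] yields its finite list only under a double negation, hence the argument by
     contradiction. *)
  apply NNPP; intros Hno.
  apply (compactness_list 2 (- M, (- M, tt)) (M, (M, tt)) del). intros [l Hl].
  apply Hno. exists (Datatypes.S (list_max (map idx l))).
  intros p Hp. destruct (HM p Hp) as [H1 H2].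
  apply Rabs_le_between in H1, H2.
  destruct (Hl (fst p, (snd p, tt))) as [[x [y []]] [Hin [_ [Hx [Hy _]]]]].
  { simpl; auto. }
  exists (idx (x, (y, tt))). split.
  - assert (Hall := proj1 (list_max_le (map idx l) _) (le_n _)).
    rewrite Forall_forall in Hall.
    specialize (Hall (idx (x, (y, tt))) (in_map idx l _ Hin)). lia.
  - apply (Hidx (x, (y, tt)) p Hp Hx Hy).
Qed.

Lemma area_finite_cover (A : R * R -> Prop) (r eps : R) :
  compact2 A -> area A = EFin r -> 0 < eps ->
  exists l : list ((R * R) * (R * R)),
    (forall q, In q l -> fst (fst q) <= snd (fst q) /\ fst (snd q) <= snd (snd q)) /\
    (forall p, A p -> exists q, In q l /\ fst (fst q) < fst p < snd (fst q) /\
                                fst (snd q) < snd p < snd (snd q)) /\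
    lsum (fun q => (snd (fst q) - fst (fst q)) * (snd (snd q) - fst (snd q))) l <= r + eps.
Proof.
  intros HA Hr Heps. apply einf_EFin in Hr.
  destruct (glb_approx _ _ _ Hr Heps) as [t [[a [b [c [d [Hle [Hcov Hsum]]]]]] Ht]].
  destruct (compact2_finite_subcover A a b c d HA Hcov) as [N HN].
  exists (map (fun n => ((a n, b n), (c n, d n))) (seq 0 N)). split; [|split].
  - intros q Hq; apply in_map_iff in Hq as [n [<- _]]; apply Hle.
  - intros p Hp. destruct (HN p Hp) as [n [Hn Hp2]].
    exists ((a n, b n), (c n, d n)); split; [|exact Hp2].
    apply in_map_iff; exists n; split; [reflexivity|apply in_seq; lia].
  - rewrite lsum_map; simpl. apply Rle_trans with t; [|lra].
    apply infinite_sum_ge_lsum with (2 := Hsum).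
    intros n; specialize (Hle n); apply Rmult_le_pos; lra.
Qed.

(** * Stable sets made of rows and columns of a grid *)

Definition in_cell (h : R) (k : nat) (x : R) : Prop := INR k * h <= x < (INR k + 1) * h.

Definition propb (P : Prop) : bool := if excluded_middle_informative P then true else false.

Lemma propb_true (P : Prop) : propb P = true <-> P.
Proof.
  unfold propb; destruct (excluded_middle_informative P); split; auto; discriminate.
Qed.

(* For [q] in [l], the rectangle [q] meets the line at [x] when [x] lies in [I q], and then
   in a segment of length [|J q|]. *)
Definition profile {T : Type} (f : R -> R) (I J : T -> R * R) (l : list T) (x : R) : R :=
  f x + lsum (fun q => ind (fst (I q) < x < snd (I q)) * (snd (J q) - fst (J q))) l.

(** The section is covered by the sides [J q] of the rectangles that the line crosses and by the
    cells where [G > r]. Keeping [I] and [J] abstract lets the lemma serve both rows and columns. *)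
Lemma leb1_line {T : Type} (f : R -> R) (I J : T -> R * R) (l : list T) (h : R)
    (ks : list nat) (G : nat -> R) (r x : R) (S : R -> Prop) :
  0 < h -> (forall q, In q l -> fst (J q) <= snd (J q)) ->
  (forall s, S s ->
     (exists q, In q l /\ fst (I q) < x < snd (I q) /\ fst (J q) < s < snd (J q)) \/
     (exists k, In k ks /\ G k > r /\ in_cell h k s)) ->
  exists m, leb1 S = EFin m /\ 0 <= m /\ m + f x <= profile f I J l x + superlevel h ks G r.
Proof.
  intros Hh HJ HS.
  set (cell := fun k : nat => (INR k * h, (INR k + 1) * h)).
  set (L := map J (filter (fun q => propb (fst (I q) < x < snd (I q))) l)
            ++ map cell (filter (fun k => propb (G k > r)) ks)).
  destruct (leb1_intervals (fun i : R * R => i) L S) as [m [Hm Hb]].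
  - intros i Hi. apply in_app_or in Hi as [Hi|Hi]; apply in_map_iff in Hi as [q [<- Hq]];
      apply filter_In in Hq as [Hq _]; [auto|]. simpl. lra.
  - intros s Hs. apply HS in Hs as [[q [Hq [H1 H2]]]|[k [Hk [H1 H2]]]].
    + exists (J q). split; [|lra]. apply in_or_app; left. apply in_map, filter_In.
      split; [exact Hq|apply propb_true, H1].
    + exists (cell k). split; [|unfold in_cell in H2; simpl; lra].
      apply in_or_app; right. apply in_map, filter_In.
      split; [exact Hk|apply propb_true, H1].
  - exists m. split; [exact Hm|split; [lra|]].
    unfold L in Hb. rewrite lsum_app, !lsum_map in Hb.
    rewrite (lsum_filter _ (fun q => fst (I q) < x < snd (I q))) in Hb
      by (intros; apply propb_true).
    rewrite (lsum_filter _ (fun k => G k > r)) in Hb by (intros; apply propb_true).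
    unfold profile, superlevel. rewrite <- lsum_scal.
    replace (lsum (fun k => h * ind (G k > r)) ks)
      with (lsum (fun k => ind (G k > r) * (snd (cell k) - fst (cell k))) ks); [lra|].
    apply lsum_ext; intros; simpl; ring.
Qed.

Lemma Zab_down (a x y x' y' : R) :
  0 <= x <= x' -> 0 <= y <= y' -> Zab a (x', y') -> Zab a (x, y).
Proof.
  unfold Zab, Rtil; simpl; intros Hx Hy H; destruct H; [left|right]; lra.
Qed.

(** The first alternative is for points beyond the last cell, where the profiles in question
    vanish. *)
Definition dominated (h : R) (K : nat) (phi : R -> R) (F : nat -> R) : Prop :=
  forall x, 0 <= x -> phi x <= 0 \/
    exists k, In k (seq 0 K) /\ in_cell h k x /\ phi x <= F k.

(* The columns with [G > r], the rows with [F > s] and the cover of [A] form a set which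
   is closed under the dynamics. *)
Lemma grid_not_spanning (a h : R) (K : nat) (f g : R -> R) (A : R * R -> Prop)
    (l : list ((R * R) * (R * R))) (F G : nat -> R) (s r : R) :
  0 < h -> 0 <= s -> 0 <= r ->
  (forall x, 0 <= x -> 0 <= f x) -> (forall x, 0 <= x -> 0 <= g x) ->
  compact2 A ->
  (forall q, In q l -> fst (fst q) <= snd (fst q) /\ fst (snd q) <= snd (snd q)) ->
  (forall p, A p -> exists q, In q l /\ fst (fst q) < fst p < snd (fst q) /\
                              fst (snd q) < snd p < snd (snd q)) ->
  dominated h K (profile f snd fst l) F ->
  dominated h K (profile g fst snd l) G ->
  Zab a (s + superlevel h (seq 0 K) G r, r + superlevel h (seq 0 K) F s) ->
  ~ espans (Zab a) f g A.
Proof.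
  intros Hh Hs Hr Hf Hg [[M HM] _] Hl Hcov HF HG HZ Hspan.
  set (U := fun u => exists k, In k (seq 0 K) /\ G k > r /\ in_cell h k u).
  set (V := fun v => exists k, In k (seq 0 K) /\ F k > s /\ in_cell h k v).
  assert (Hinv : forall n p, Titer (Zab a) f g n A p -> A p \/ U (fst p) \/ V (snd p)).
  { induction n as [|n IH]; [auto|]. simpl. intros p [Hp|[[Hp1 Hp2] Hp]]; [auto|].
    apply NNPP; intros Hno. apply Hp; clear Hp.
    destruct (leb1_line f snd fst l h (seq 0 K) G r (snd p)
                (fun x => Titer (Zab a) f g n A (x, snd p))) as [m [Hm [Hm0 Hm1]]].
    { exact Hh. }
    { intros q Hq; apply Hl, Hq. }
    { intros x Hx. destruct (IH _ Hx) as [HA|[HU|HV]]; simpl in *.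
      - left. destruct (Hcov _ HA) as [q [Hq Hqq]]. simpl in Hqq. exists q. tauto.
      - right; exact HU.
      - tauto. }
    destruct (leb1_line g fst snd l h (seq 0 K) F s (fst p)
                (fun x => Titer (Zab a) f g n A (fst p, x))) as [m' [Hm' [Hm0' Hm1']]].
    { exact Hh. }
    { intros q Hq; apply Hl, Hq. }
    { intros x Hx. destruct (IH _ Hx) as [HA|[HU|HV]]; simpl in *.
      - left. destruct (Hcov _ HA) as [q [Hq Hqq]]. simpl in Hqq. exists q. tauto.
      - tauto.
      - right; exact HV. }
    unfold trow, tcol. rewrite Hm, Hm'. simpl.
    specialize (Hf _ Hp2). specialize (Hg _ Hp1).
    (* Because [p] lies in no row of [V], its profile is at most [s]; the selected columns
       contribute the remaining summand of the first coordinate in [HZ]. The second coordinate is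
       symmetric. *)
    assert (profile f snd fst l (snd p) <= s).
    { destruct (HF _ Hp2) as [H|[k [Hk [Hc H]]]]; [lra|].
      apply Rnot_lt_le; intros Hlt. apply Hno. right; right. exists k.
      repeat split; try apply Hc; [exact Hk|lra]. }
    assert (profile g fst snd l (fst p) <= r).
    { destruct (HG _ Hp1) as [H'|[k [Hk [Hc H']]]]; [lra|].
      apply Rnot_lt_le; intros Hlt. apply Hno. right; left. exists k.
      repeat split; try apply Hc; [exact Hk|lra]. }
    eapply Zab_down; [| |exact HZ]; lra. }
  (* The point [(B, B)] lies beyond [A] and beyond every cell, so the dynamics never reaches it. *)
  set (B := Rmax (INR K * h) (M + 1)).
  assert (HB1 : INR K * h <= B) by apply Rmax_l.
  assert (HB2 : M + 1 <= B) by apply Rmax_r.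
  assert (HB0 : 0 <= B).
  { apply Rle_trans with (2 := HB1). apply Rmult_le_pos; [apply pos_INR|lra]. }
  assert (Hcell : forall k, In k (seq 0 K) -> ~ in_cell h k B).
  { intros k Hk [_ Hc]. apply in_seq in Hk.
    assert (INR (S k) * h <= INR K * h).
    { apply Rmult_le_compat_r; [lra|]. apply le_INR; lia. }
    rewrite S_INR in H. lra. }
  destruct (proj2 (Hspan (B, B))) as [n Hn]; [split; exact HB0|].
  destruct (Hinv _ _ Hn) as [HA|[[k [Hk [_ Hc]]]|[k [Hk [_ Hc]]]]].
  - apply HM in HA as [HA _]. simpl in HA. assert (H := Rle_abs B). lra.
  - apply (Hcell k Hk Hc).
  - apply (Hcell k Hk Hc).
Qed.

(** * Discretization: step functions above the profiles and their sums *)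

Definition cell_value {T : Type} (f : R -> R) (I J : T -> R * R) (l : list T) (h : R)
    (k : nat) : R :=
  f (INR k * h) +
  lsum (fun q => ind (INR k * h < snd (I q) /\ fst (I q) < (INR k + 1) * h)
                 * (snd (J q) - fst (J q))) l.

Lemma exists_cell (h : R) (K : nat) (x : R) :
  0 < h -> 0 <= x < INR K * h -> exists k, In k (seq 0 K) /\ in_cell h k x.
Proof.
  intros Hh; induction K as [|K IH]; intros Hx; [simpl in Hx; lra|].
  destruct (Rlt_le_dec x (INR K * h)) as [Hlt|Hle].
  - destruct IH as [k [Hk Hc]]; [lra|]. exists k; split; [|exact Hc].
    apply in_seq in Hk; apply in_seq; lia.
  - exists K. split; [apply in_seq; lia|]. rewrite S_INR in Hx. split; lra.
Qed.

(** On a cell the nonincreasing [f] is at most its value at the left end, and [cell_value] counts in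
    full every rectangle whose side [I q] meets the cell. *)
Lemma dominated_cell_value {T : Type} (f : R -> R) (I J : T -> R * R) (l : list T)
    (h : R) (K : nat) :
  0 < h -> (forall x y, 0 <= x -> x <= y -> f y <= f x) ->
  (forall x, INR K * h <= x -> f x = 0) ->
  (forall q, In q l -> fst (J q) <= snd (J q) /\ snd (I q) <= INR K * h) ->
  dominated h K (profile f I J l) (cell_value f I J l h).
Proof.
  intros Hh Hf Hf0 Hl x Hx.
  destruct (Rlt_le_dec x (INR K * h)) as [Hlt|Hle].
  - right. destruct (exists_cell h K x Hh (conj Hx Hlt)) as [k [Hk Hc]].
    exists k; split; [exact Hk|split; [exact Hc|]]. destruct Hc as [Hc1 Hc2].
    apply Rplus_le_compat.
    + apply Hf; [|exact Hc1]. apply Rmult_le_pos; [apply pos_INR|lra].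
    + apply lsum_le; intros q Hq. apply Rmult_le_compat_r.
      * destruct (Hl q Hq); lra.
      * apply ind_impl; lra.
  - left. unfold profile. rewrite (Hf0 x Hle), Rplus_0_l.
    rewrite (lsum_ext _ (fun _ => 0)); [rewrite lsum_const; lra|].
    intros q Hq. destruct (Hl q Hq).
    destruct (ind_cases (fst (I q) < x < snd (I q))) as [[? ->]|[_ ->]]; lra.
Qed.

Lemma cell_value_ge_0 {T : Type} (f : R -> R) (I J : T -> R * R) (l : list T)
    (h : R) (k : nat) :
  0 < h -> (forall x, 0 <= x -> 0 <= f x) ->
  (forall q, In q l -> fst (J q) <= snd (J q)) -> 0 <= cell_value f I J l h k.
Proof.
  intros Hh Hf Hl. apply Rplus_le_le_0_compat.
  - apply Hf, Rmult_le_pos; [apply pos_INR|lra].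
  - apply lsum_nonneg; intros q Hq. apply Rmult_le_pos; [apply ind_bounds|].
    specialize (Hl q Hq); lra.
Qed.

(** A cell counted here lies between [c - h] and [d + h], and distinct cells do not overlap. The
    [Rmax] and [Rmin] bound expresses this for the first [K] cells, which allows induction on
    [K]. *)
Lemma cells_meeting_interval (h c d : R) (K : nat) :
  0 < h -> c <= d ->
  h * lsum (fun k => ind (INR k * h < d /\ c < (INR k + 1) * h)) (seq 0 K) <= d - c + 2 * h.
Proof.
  intros Hh Hcd.
  assert (H : h * lsum (fun k => ind (INR k * h < d /\ c < (INR k + 1) * h)) (seq 0 K)
              <= Rmax 0 (Rmin (INR K * h) (d + h) - (c - h))).
  { induction K as [|K IH]; [simpl; rewrite Rmult_0_r; apply Rmax_l|].
    rewrite lsum_seq_S, S_INR.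
    destruct (ind_cases (INR K * h < d /\ c < (INR K + 1) * h)) as [[HP ->]|[HP ->]].
    - rewrite Rmin_left in IH by lra. rewrite Rmax_right in IH by lra.
      rewrite Rmin_left by lra. rewrite Rmax_right; lra.
    - rewrite Rplus_0_r. eapply Rle_trans; [exact IH|].
      apply Rle_max_compat_l, Rplus_le_compat_r, Rle_min_compat_r. lra. }
  eapply Rle_trans; [exact H|]. apply Rmax_lub; [lra|].
  assert (Rmin (INR K * h) (d + h) <= d + h) by apply Rmin_r. lra.
Qed.

(** Frees the upper limit of integration, since the end of the grid need not be the support bound
    chosen in [integral0inf]. *)
Lemma integral0inf_RInt (f : R -> R) (If : R) :
  integral0inf f If -> exists M, 0 <= M /\
    forall b, M <= b -> ex_RInt f 0 b /\ RInt f 0 b = If.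
Proof.
  intros [M [HM [Hf0 [pr Hpr]]]]. exists M; split; [exact HM|]. intros b Hb.
  assert (E1 : ex_RInt f 0 M) by (apply ex_RInt_Reals_1, pr).
  assert (Hz : is_RInt f M b 0).
  { apply is_RInt_ext with (fun _ => 0).
    - intros x Hx. rewrite Rmin_left in Hx by lra. symmetry; apply Hf0; lra.
    - assert (Hc := is_RInt_const M b (0 : R_NormedModule)).
      match type of Hc with is_RInt _ _ _ ?v => replace v with 0 in Hc end; [exact Hc|].
      symmetry; apply Rmult_0_r. }
  assert (H := is_RInt_Chasles f 0 M b _ _ (RInt_correct f 0 M E1) Hz).
  rewrite (RInt_Reals f 0 M pr), Hpr in H.
  change (plus If 0) with (If + 0) in H. rewrite Rplus_0_r in H.
  split; [eexists; exact H|apply is_RInt_unique, H].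
Qed.

Lemma integral0inf_ge_0 (f : R -> R) (If : R) :
  (forall x, 0 <= x -> 0 <= f x) -> integral0inf f If -> 0 <= If.
Proof.
  intros Hf Hi. apply integral0inf_RInt in Hi as [M [HM HR]].
  destruct (HR M (Rle_refl M)) as [H1 <-].
  apply RInt_ge_0; [exact HM|exact H1|]. intros; apply Hf; lra.
Qed.

(** By monotonicity the values at right ends of cells give a lower sum for the integral; passing to
    left ends costs at most [h * f 0]. *)
Lemma upper_sum_le_integral (f : R -> R) (If h : R) (K : nat) :
  0 < h -> (forall x, 0 <= x -> 0 <= f x) ->
  (forall x y, 0 <= x -> x <= y -> f y <= f x) -> integral0inf f If ->
  h * lsum (fun k => f (INR k * h)) (seq 0 K) <= If + h * f 0.
Proof.
  intros Hh Hf Hmon Hi. apply integral0inf_RInt in Hi as [M [HM HR]].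
  assert (Hex : forall b c, 0 <= b <= c -> ex_RInt f b c).
  { intros b c Hbc. assert (HB1 := Rmax_l M c). assert (HB2 := Rmax_r M c).
    destruct (HR (Rmax M c) HB1) as [H _].
    apply (ex_RInt_Chasles_2 f 0); [exact Hbc|].
    apply (ex_RInt_Chasles_1 f 0 c (Rmax M c)); [lra|exact H]. }
  assert (HK : forall k, 0 <= INR k * h).
  { intros k; apply Rmult_le_pos; [apply pos_INR|lra]. }
  assert (Hk : h * lsum (fun k => f (INR (S k) * h)) (seq 0 K) <= RInt f 0 (INR K * h)).
  { clear HR. induction K as [|K IH].
    - simpl. rewrite Rmult_0_l, Rmult_0_r.
      rewrite (RInt_point (V := R_CompleteNormedModule)). apply Rle_refl.
    - rewrite lsum_seq_S. specialize (HK K).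
      rewrite <- (RInt_Chasles f 0 (INR K * h)) by
        (apply Hex; rewrite ?S_INR; lra).
      assert (h * f (INR (S K) * h) <= RInt f (INR K * h) (INR (S K) * h)).
      { replace (h * f (INR (S K) * h))
          with (RInt (fun _ => f (INR (S K) * h)) (INR K * h) (INR (S K) * h)).
        - apply RInt_le.
          + rewrite S_INR; lra.
          + apply ex_RInt_const.
          + apply Hex; rewrite S_INR; lra.
          + intros x Hx; apply Hmon; lra.
        - transitivity ((INR (S K) * h - INR K * h) * f (INR (S K) * h)).
          + apply (RInt_const (V := R_CompleteNormedModule)).
          + rewrite S_INR. match goal with |- ?x = ?y => change (@eq R x y) end. ring. }
      unfold plus; simpl in *. lra. }
  assert (RInt f 0 (INR K * h) <= If).
  { set (B := Rmax M (INR K * h)). assert (HB1 : M <= B) by apply Rmax_l.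
    assert (HB2 : INR K * h <= B) by apply Rmax_r. specialize (HK K).
    destruct (HR B HB1) as [_ <-].
    rewrite <- (RInt_Chasles f 0 (INR K * h) B) by (apply Hex; lra).
    assert (0 <= RInt f (INR K * h) B).
    { apply RInt_ge_0; [exact HB2|apply Hex; lra|]. intros; apply Hf; lra. }
    unfold plus; simpl in *. lra. }
  rewrite (lsum_seq_shift (fun k => f (INR k * h))) in Hk.
  simpl INR in Hk. rewrite Rmult_0_l in Hk.
  assert (0 <= h * f (INR K * h)) by (apply Rmult_le_pos; [lra|apply Hf, HK]).
  lra.
Qed.

(** Each rectangle contributes its area plus at most [2 * h] times its side [J q], so for a fixed
    list the error vanishes with [h]. *)
Lemma sum_cell_value_le {T : Type} (f : R -> R) (If : R) (I J : T -> R * R) (l : list T)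
    (h : R) (K : nat) :
  0 < h -> (forall x, 0 <= x -> 0 <= f x) ->
  (forall x y, 0 <= x -> x <= y -> f y <= f x) -> integral0inf f If ->
  (forall q, In q l -> fst (I q) <= snd (I q) /\ fst (J q) <= snd (J q)) ->
  h * lsum (cell_value f I J l h) (seq 0 K)
  <= If + lsum (fun q => (snd (I q) - fst (I q)) * (snd (J q) - fst (J q))) l
     + h * (f 0 + 2 * lsum (fun q => snd (J q) - fst (J q)) l).
Proof.
  intros Hh Hf Hmon Hi Hl.
  assert (H1 := upper_sum_le_integral f If h K Hh Hf Hmon Hi).
  unfold cell_value. rewrite lsum_plus, lsum_exchange.
  assert (H2 : h * lsum (fun q => lsum (fun k =>
                 ind (INR k * h < snd (I q) /\ fst (I q) < (INR k + 1) * h)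
                 * (snd (J q) - fst (J q))) (seq 0 K)) l
    <= lsum (fun q => (snd (I q) - fst (I q)) * (snd (J q) - fst (J q))
                      + 2 * h * (snd (J q) - fst (J q))) l).
  { rewrite <- lsum_scal. apply lsum_le; intros q Hq. destruct (Hl q Hq) as [HI HJ].
    assert (HC := cells_meeting_interval h (fst (I q)) (snd (I q)) K Hh HI).
    rewrite (lsum_ext _ (fun k => (snd (J q) - fst (J q)) *
      ind (INR k * h < snd (I q) /\ fst (I q) < (INR k + 1) * h))) by (intros; ring).
    rewrite lsum_scal.
    apply Rle_trans with ((snd (J q) - fst (J q)) * (snd (I q) - fst (I q) + 2 * h)).
    - rewrite <- Rmult_assoc, (Rmult_comm h), Rmult_assoc.
      apply Rmult_le_compat_l; [lra|exact HC].
    - lra. }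
  rewrite lsum_plus, lsum_scal in H2. lra.
Qed.

(** * The lower bound on integrals and area *)

Lemma list_upper_bound {T : Type} (w : T -> R) (l : list T) :
  exists B, forall q, In q l -> w q <= B.
Proof.
  induction l as [|x l [B HB]]; [exists 0; intros q []|].
  exists (Rmax (w x) B). intros q [<-|Hq]; [apply Rmax_l|].
  eapply Rle_trans; [apply HB, Hq|apply Rmax_r].
Qed.

Lemma Rmax_plus_Rmin_1 (x : R) : Rmax 0 (x - 1) + Rmin x 1 = x.
Proof.
  unfold Rmax, Rmin; destruct (Rle_dec 0 (x - 1)); destruct (Rle_dec x 1); lra.
Qed.

Lemma espans_integrals_ge (a : R) (A : R * R -> Prop) (f g : R -> R) (ar If Ig : R) :
  1 <= a -> compact2 A -> admissible f -> admissible g -> espans (Zab a) f g A ->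
  area A = EFin ar -> integral0inf f If -> integral0inf g Ig ->
  2 * (a - 1) <= If + Ig + 2 * ar.
Proof.
  intros Ha HA [Hf [Hfm [_ [Mf HMf]]]] [Hg [Hgm [_ [Mg HMg]]]] Hspan Har HIf HIg.
  apply le_epsilon; intros eps Heps.
  destruct (area_finite_cover A ar (eps / 4) HA Har ltac:(lra)) as [l [Hl [Hcov Hsum]]].
  set (Wf := f 0 + 2 * lsum (fun q : (R * R) * (R * R) => snd (fst q) - fst (fst q)) l).
  set (Wg := g 0 + 2 * lsum (fun q : (R * R) * (R * R) => snd (snd q) - fst (snd q)) l).
  assert (HWf : 0 <= Wf).
  { apply Rplus_le_le_0_compat; [apply Hf; lra|]. apply Rmult_le_pos; [lra|].
    apply lsum_nonneg; intros q Hq; destruct (Hl q Hq); lra. }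
  assert (HWg : 0 <= Wg).
  { apply Rplus_le_le_0_compat; [apply Hg; lra|]. apply Rmult_le_pos; [lra|].
    apply lsum_nonneg; intros q Hq; destruct (Hl q Hq); lra. }
  (* [Wf] and [Wg] are the grid errors per unit of [h]. This choice bounds them together by
     [eps / 4]; the cover of [A], used once for [F] and once for [G], adds another [eps / 2]. *)
  set (h := eps / 4 / (Wf + Wg + 1)).
  assert (Hh : 0 < h) by (apply Rdiv_lt_0_compat; lra).
  assert (HhW : h * (Wf + Wg) <= eps / 4).
  { replace (eps / 4) with (h * (Wf + Wg + 1)) by (unfold h; field; lra).
    apply Rmult_le_compat_l; lra. }
  destruct (list_upper_bound (fun q : (R * R) * (R * R) => snd (fst q)) l) as [B1 HB1].
  destruct (list_upper_bound (fun q : (R * R) * (R * R) => snd (snd q)) l) as [B2 HB2].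
  (* The grid must reach beyond the supports of [f] and [g] and beyond all rectangles of the
     cover. *)
  assert (HK : exists K, forall B, In B (Mf :: Mg :: B1 :: B2 :: nil) -> B <= INR K * h).
  { destruct (list_upper_bound (fun B => B) (Mf :: Mg :: B1 :: B2 :: nil)) as [B HB].
    destruct (INR_unbounded (B / h)) as [K HK].
    exists K; intros b Hb. apply Rle_trans with (1 := HB b Hb).
    replace B with (B / h * h) by (field; lra). apply Rmult_le_compat_r; lra. }
  destruct HK as [K HK].
  assert (HKf : Mf <= INR K * h) by (apply HK; simpl; auto).
  assert (HKg : Mg <= INR K * h) by (apply HK; simpl; auto).
  assert (HK1 : B1 <= INR K * h) by (apply HK; simpl; auto).
  assert (HK2 : B2 <= INR K * h) by (apply HK; simpl; auto).
  set (F := cell_value f snd fst l h). set (G := cell_value g fst snd l h).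
  assert (HF0 : forall k, 0 <= F k).
  { intros k; apply cell_value_ge_0; auto. intros q Hq; apply Hl, Hq. }
  assert (HG0 : forall k, 0 <= G k).
  { intros k; apply cell_value_ge_0; auto. intros q Hq; apply Hl, Hq. }
  assert (HFd : dominated h K (profile f snd fst l) F).
  { apply dominated_cell_value; auto.
    - intros x Hx; apply HMf; lra.
    - intros q Hq; split; [apply Hl, Hq|]. specialize (HB2 q Hq); simpl in HB2; lra. }
  assert (HGd : dominated h K (profile g fst snd l) G).
  { apply dominated_cell_value; auto.
    - intros x Hx; apply HMg; lra.
    - intros q Hq; split; [apply Hl, Hq|]. specialize (HB1 q Hq); simpl in HB1; lra. }
  assert (Hno : forall s r, 0 <= s -> 0 <= r ->
    ~ Zab a (s + superlevel h (seq 0 K) G r, r + superlevel h (seq 0 K) F s)).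
  { intros s r Hs Hr HZ.
    apply (grid_not_spanning a h K f g A l F G s r); auto. }
  assert (Hpos : forall H s, 0 <= superlevel h (seq 0 K) H s).
  { intros; apply superlevel_nonneg; lra. }
  assert (T1 : a - 1 <= h * lsum (fun k => Rmax 0 (F k - 1)) (seq 0 K)
                        + h * lsum (fun k => Rmin (G k) 1) (seq 0 K)).
  { apply superlevel_tradeoff; auto. intros y Hy Hle.
    (* With these levels the first coordinate equals [a], and a superlevel set of [F] shorter than
       [y] would keep the second below [1]: a point of the rectangle [Rtil a 1]. *)
    apply Rnot_lt_le; intros Hlt.
    apply (Hno (a - superlevel h (seq 0 K) G (1 - y)) (1 - y)); [lra|lra|].
    left. unfold Rtil; simpl.
    assert (H1 := Hpos F (a - superlevel h (seq 0 K) G (1 - y))). lra. }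
  assert (T2 : a - 1 <= h * lsum (fun k => Rmax 0 (G k - 1)) (seq 0 K)
                        + h * lsum (fun k => Rmin (F k) 1) (seq 0 K)).
  { apply superlevel_tradeoff; auto. intros y Hy Hle.
    apply Rnot_lt_le; intros Hlt.
    apply (Hno (1 - y) (a - superlevel h (seq 0 K) F (1 - y))); [lra|lra|].
    right. unfold Rtil; simpl.
    assert (H1 := Hpos G (a - superlevel h (seq 0 K) F (1 - y))). lra. }
  (* The excess above [1] from one inequality and the part below [1] from the other recombine to the
     full sums of [F] and [G]. *)
  assert (EF : lsum (fun k => Rmax 0 (F k - 1)) (seq 0 K)
               + lsum (fun k => Rmin (F k) 1) (seq 0 K) = lsum F (seq 0 K)).
  { rewrite <- lsum_plus. apply lsum_ext; intros; apply Rmax_plus_Rmin_1. }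
  assert (EG : lsum (fun k => Rmax 0 (G k - 1)) (seq 0 K)
               + lsum (fun k => Rmin (G k) 1) (seq 0 K) = lsum G (seq 0 K)).
  { rewrite <- lsum_plus. apply lsum_ext; intros; apply Rmax_plus_Rmin_1. }
  assert (SF := sum_cell_value_le f If snd fst l h K Hh Hf Hfm HIf
                  (fun q Hq => conj (proj2 (Hl q Hq)) (proj1 (Hl q Hq)))).
  assert (SG := sum_cell_value_le g Ig fst snd l h K Hh Hg Hgm HIg Hl).
  rewrite (lsum_ext _ (fun q => (snd (fst q) - fst (fst q)) * (snd (snd q) - fst (snd q))))
    in SF by (intros; ring).
  fold F Wf in SF. fold G Wg in SG.
  rewrite <- EF in SF. rewrite <- EG in SG. lra.
Qed.

(** * Step functions and the spanning example for the upper bound *)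

Definition block (c L x : R) : R := if Rle_dec x L then c else 0.

Lemma block_le (c L x : R) : x <= L -> block c L x = c.
Proof. unfold block; destruct (Rle_dec x L); lra. Qed.

Lemma block_gt (c L x : R) : L < x -> block c L x = 0.
Proof. unfold block; destruct (Rle_dec x L); lra. Qed.

Lemma block_admissible (c L : R) : 0 <= c -> 0 <= L -> admissible (block c L).
Proof.
  intros Hc HL; unfold admissible. split; [|split; [|split]].
  - intros x _; unfold block; destruct (Rle_dec x L); lra.
  - intros x y _ Hxy; unfold block; destruct (Rle_dec x L), (Rle_dec y L); lra.
  - intros x Hx eps Heps. destruct (Rle_lt_dec x L) as [Hle|Hlt].
    + exists 1; split; [lra|]. intros y _ Hy. rewrite !block_le by lra.
      rewrite Rminus_diag, Rabs_R0; exact Heps.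
    + exists (x - L); split; [lra|]. intros y _ Hy. rewrite !block_gt by lra.
      rewrite Rminus_diag, Rabs_R0; exact Heps.
  - exists (L + 1); intros x Hx. apply block_gt; lra.
Qed.

Lemma block_integral (c L : R) : 0 <= L -> integral0inf (block c L) (L * c).
Proof.
  intros HL.
  assert (H1 : is_RInt (block c L) 0 L (scal (L - 0) c)).
  { apply is_RInt_ext with (fun _ => c); [|apply (is_RInt_const (V := R_NormedModule))].
    intros x Hx. rewrite Rmin_left, Rmax_right in Hx by lra. rewrite block_le; lra. }
  assert (H2 : is_RInt (block c L) L (L + 1) (scal (L + 1 - L) 0)).
  { apply is_RInt_ext with (fun _ => 0); [|apply (is_RInt_const (V := R_NormedModule))].
    intros x Hx. rewrite Rmin_left, Rmax_right in Hx by lra. rewrite block_gt; lra. }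
  assert (H := is_RInt_Chasles _ _ _ _ _ _ H1 H2).
  (* The endpoint [L] itself would not do, since [block] need not vanish there. *)
  exists (L + 1). split; [lra|split; [intros; apply block_gt; lra|]].
  exists (ex_RInt_Reals_0 _ _ _ (ex_intro _ _ H)).
  rewrite <- RInt_Reals. rewrite (is_RInt_unique _ _ _ _ H).
  change ((L - 0) * c + (L + 1 - L) * 0 = L * c). ring.
Qed.

Lemma Titer_quadrant (Z : R * R -> Prop) (f g : R -> R) (A : R * R -> Prop) (n : nat)
    (p : R * R) :
  (forall q, A q -> quadrant q) -> Titer Z f g n A p -> quadrant p.
Proof.
  intros HA; revert p; induction n as [|n IH]; [exact HA|]. intros p [Hp|[Hp _]]; auto.
Qed.

(** An infinite length is never in the zero-set, so lower bounds [lx] and [ly] are required only for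
    finite lengths. The disjunction says that the point lies outside both rectangles. *)
Lemma not_zin_Zab (a lx ly x y : R) (S S' : R -> Prop) :
  1 <= a ->
  (forall m, leb1 S = EFin m -> lx <= m) -> (forall m, leb1 S' = EFin m -> ly <= m) ->
  a < lx + x \/ a < ly + y \/ (1 < lx + x /\ 1 < ly + y) ->
  ~ zin (Zab a) (eadd (leb1 S) (EFin x)) (eadd (leb1 S') (EFin y)).
Proof.
  intros Ha HS HS' Hbig HZ.
  destruct (leb1 S) as [m| |]; [|exact HZ..].
  destruct (leb1 S') as [m'| |]; [|exact HZ..].
  specialize (HS m eq_refl). specialize (HS' m' eq_refl).
  unfold zin, Zab, Rtil in HZ; simpl in HZ. lra.
Qed.

(* The square [[0, L]^2] fills first, then the rows and columns through it, then everything. *)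
Lemma block_espans (a c L : R) :
  1 <= a -> 1 < c -> 1 < L -> a < c + L ->
  espans (Zab a) (block c L) (block c L) (fun _ => False).
Proof.
  intros Ha Hc HL HcL p. split.
  { intros [n Hn]. eapply Titer_quadrant; [|exact Hn]. intros q []. }
  set (B := fun n => Titer (Zab a) (block c L) (block c L) n (fun _ => False)).
  assert (B1 : forall u v, 0 <= u <= L -> 0 <= v <= L -> B 1%nat (u, v)).
  { intros u v Hu Hv. right. split; [split; simpl; lra|].
    apply not_zin_Zab with (lx := 0) (ly := 0); [lra|apply leb1_ge_0..|].
    simpl; rewrite !block_le by lra. lra. }
  assert (B2 : forall u v, 0 <= u -> 0 <= v -> u <= L \/ v <= L -> B 2%nat (u, v)).
  { intros u v Hu Hv Huv. right. split; [split; simpl; lra|].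
    destruct (Rle_lt_dec v L) as [HvL|HvL].
    (* The occupied square gives length [L] on this row, and [L + c > a]. *)
    - apply not_zin_Zab with (lx := L) (ly := 0); [lra| |apply leb1_ge_0|].
      + intros m; apply leb1_ge_interval; [lra|]. intros x Hx; apply B1; simpl; lra.
      + simpl; rewrite (block_le _ _ v) by lra. lra.
    - apply not_zin_Zab with (lx := 0) (ly := L); [lra|apply leb1_ge_0| |].
      + intros m; apply leb1_ge_interval; [lra|]. intros x Hx; apply B1; simpl; lra.
      + simpl; rewrite (block_le _ _ u) by lra. lra. }
  destruct p as [u v]; intros [Hu Hv]; simpl in Hu, Hv. exists 3%nat.
  right. split; [split; assumption|].
  destruct (block_admissible c L) as [Hpos _]; [lra..|].
  (* Every line now contains an occupied segment of length [L > 1], in both directions. *)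
  apply not_zin_Zab with (lx := L) (ly := L); [lra| | |].
  - intros m; apply leb1_ge_interval; [lra|]. intros x Hx; apply B2; simpl; lra.
  - intros m; apply leb1_ge_interval; [lra|]. intros x Hx; apply B2; simpl; lra.
  - simpl. assert (H1 := Hpos u Hu). assert (H2 := Hpos v Hv). lra.
Qed.

Theorem mainTheorem17 (a alpha : R) (ha : 2 <= a) (halpha : 0 <= alpha <= 1) :
  ele (EFin (2 * (a - 1) * ((1 - alpha) - 2 * (1 - alpha) ^ 2))) (Itil alpha alpha (Zab a)) /\
  ele (Itil alpha alpha (Zab a)) (EFin (2 * (a - 1) * (1 - alpha))).
Proof.
  unfold Itil.
  match goal with |- ele (EFin ?m) (einf ?E) /\ _ => set (lower := m); set (values := E) end.
  assert (Hlow : forall v, values v -> lower <= v).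
  { intros v (A & f & g & ar & If & Ig & HA & Hf & Hg & Hspan & Har & HIf & HIg & ->).
    assert (H := espans_integrals_ge a A f g ar If Ig ltac:(lra) HA Hf Hg Hspan Har HIf HIg).
    assert (Har0 := area_ge_0 A ar Har).
    assert (HIf0 := integral0inf_ge_0 f If (proj1 Hf) HIf).
    assert (HIg0 := integral0inf_ge_0 g Ig (proj1 Hg) HIg).
    unfold lower. set (e := 1 - alpha) in *. assert (He : 0 <= e <= 1) by (unfold e; lra).
    (* For [e <= 1 / 2] the area term splits as [2 * e * ar] plus a nonnegative rest, and [e] times
       the bound [H] suffices. For [e > 1 / 2] the claimed lower bound is at most zero. *)
    destruct (Rle_lt_dec e (1 / 2)) as [Hle|Hgt].
    - assert (e * (2 * (a - 1)) <= e * (If + Ig + 2 * ar)) by (apply Rmult_le_compat_l; lra).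
      assert (0 <= ar * (1 - 2 * e)) by (apply Rmult_le_pos; lra).
      assert (0 <= (a - 1) * (e * e)) by (repeat apply Rmult_le_pos; lra).
      lra.
    - assert (0 <= (a - 1) * (e * (2 * e - 1))) by (repeat apply Rmult_le_pos; lra).
      assert (0 <= e * (If + Ig)) by (apply Rmult_le_pos; lra).
      lra. }
  (* Height [a - 1 + d] and width [1 + d] make the inequalities for spanning strict; the height
     exceeds [1] because [a >= 2]. *)
  assert (Hval : forall d, 0 < d -> values (2 * ((1 - alpha) * ((1 + d) * (a - 1 + d))))).
  { intros d Hd. exists (fun _ => False), (block (a - 1 + d) (1 + d)),
      (block (a - 1 + d) (1 + d)), 0, ((1 + d) * (a - 1 + d)), ((1 + d) * (a - 1 + d)).
    split; [|split; [|split; [|split; [|split; [|split; [|split]]]]]].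
    - split; [exists 0; intros p []|]. intros p Hp.
      destruct (Hp 1 Rlt_0_1) as [q [[] _]].
    - apply block_admissible; lra.
    - apply block_admissible; lra.
    - apply block_espans; lra.
    - apply area_empty.
    - apply block_integral; lra.
    - apply block_integral; lra.
    - ring. }
  destruct (einf_finite values _ lower (Hval 1 Rlt_0_1) Hlow) as [m [-> [Hm1 Hm2]]].
  split; [apply Hm2, Hlow|]. simpl.
  apply le_epsilon; intros eps Heps.
  (* Since [(1 + d) * (a - 1 + d) = a - 1 + d * (a + d)], the excess over the target is at most
     [2 * d * (a + 1)] when [d <= 1]. *)
  set (d := Rmin 1 (eps / (2 * (a + 1)))).
  assert (Hd1 : d <= 1) by apply Rmin_l.
  assert (Hd2 : d <= eps / (2 * (a + 1))) by apply Rmin_r.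
  assert (Hd0 : 0 < d) by (apply Rmin_pos; [lra|apply Rdiv_lt_0_compat; lra]).
  apply Rle_trans with (1 := Hm1 _ (Hval d Hd0)).
  assert (Hd3 : d * (2 * (a + 1)) <= eps).
  { replace eps with (eps / (2 * (a + 1)) * (2 * (a + 1))) by (field; lra).
    apply Rmult_le_compat_r; lra. }
  assert (Hd4 : d * d <= d * 1) by (apply Rmult_le_compat_l; lra).
  assert (H : (1 - alpha) * (d * (a + d)) <= 1 * (d * (a + d))).
  { apply Rmult_le_compat_r; [apply Rmult_le_pos; lra|lra]. }
  lra.
Qed.
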